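(* Let $(\mathbf{E},\|\cdot\|)$ be a finite-dimensional real normed space and $\mathcal{X}\subseteq\mathbf{E}$ a closed, convex, nonempty set. Let $\bar f(\mathbf{x}) = f(\mathbf{x})+\psi(\mathbf{x})$, where $f$ is convex and $(L,\kappa)$-weakly smooth w.r.t. $\|\cdot\|$, $\kappa\in(1,2]$, and $\psi$ is $q$-uniformly convex with constant $\lambda\ge 0$ w.r.t. the same norm for some $q\ge 2$. Let $\bar{\mathbf{x}}^\star$ be the minimizer of $\bar f$ (over $\mathcal{X}$). Let $\mathbf{x}_k,\mathbf{v}_k,\mathbf{y}_k$ evolve according to Generalized AGD+ (defined in the context) for an arbitrary initial point $\mathbf{x}_0\in\mathcal{X}$, where $\delta_k>0$ and $$M_k=\Big[\frac{2(q-\kappa)}{q\kappa\delta_k}\Big]^{\frac{q-\kappa}{\kappa}}L^{\frac{q}{\kappa}}\quad (k\ge 0),\qquad A_0M_0=m_0,\qquad a_k^q\le\frac{\max\{\lambda A_{k-1}^q,\; m_0A_k^{q-1}\}}{M_k}\quad(k\ge 1).$$ Then for all $k\ge 1$: $$\bar f(\mathbf{y}_k)-\bar f(\bar{\mathbf{x}}^\star)\le\frac{2A_0M_0\,\phi(\bar{\mathbf{x}}^\star)+\sum_{i=0}^kA_i\delta_i}{2A_k}.$$ In particular, for any $\epsilon>0$, setting $\delta_k=\frac{a_k}{A_k}\epsilon$ for $k\ge 0$, $a_0=A_0=1$, and $a_k^q=\frac{\max\{\lambda A_{k-1}^q,\,m_0A_k^{q-1}\}}{M_k}$ for $k\ge1$,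 we have $\bar f(\mathbf{y}_k)-\bar f(\bar{\mathbf{x}}^\star)\le\epsilon$ after at most $$k=O\bigg(\min\bigg\{\Big(\frac1\epsilon\Big)^{\frac{q-\kappa}{q\kappa-q+\kappa}}\Big(\max\Big\{\frac{L^{q/\kappa}}{\lambda},1\Big\}\Big)^{\frac{\kappa}{q\kappa-q+\kappa}}\log\Big(\frac{L\phi(\bar{\mathbf{x}}^\star)}{\epsilon}\Big),\;\Big(\frac L\epsilon\Big)^{\frac{q}{q\kappa-q+\kappa}}\big(\phi(\bar{\mathbf{x}}^\star)\big)^{\frac{\kappa}{q\kappa-q+\kappa}}\bigg\}\bigg)$$ iterations.
   Context: All functions are proper, convex and lower semicontinuous; $\|\cdot\|_*$ is the dual norm on $\mathbf{E}^*$. A function $f:\mathbf{E}\to\mathbb{R}$ is $(L,\kappa)$-weakly smooth w.r.t. $\|\cdot\|$ ($L>0$, $\kappa\in(1,2]$) if $\|\nabla f(\mathbf{x})-\nabla f(\mathbf{y})\|_*\le L\|\mathbf{x}-\mathbf{y}\|^{\kappa-1}$ for all $\mathbf{x},\mathbf{y}$. A function $\psi$ is $(\lambda,q)$-uniformly convex, i.e. $q$-uniformly convex with constant $\lambda\ge0$ ($q\ge2$), if $\psi((1-\alpha)\mathbf{x}+\alpha\mathbf{y})\le(1-\alpha)\psi(\mathbf{x})+\alpha\psi(\mathbf{y})-\frac{\lambda}{q}\alpha(1-\alpha)\|\mathbf{y}-\mathbf{x}\|^q$ for all $\mathbf{x},\mathbf{y}$ and $\alpha\in(0,1)$. Generalized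 AGD+ with parameter $m_0$, positive numbers $\{a_k\}_{k\ge0}$ and $A_k=\sum_{i=0}^ka_i$: given $\mathbf{x}_0\in\mathcal{X}$, $$\mathbf{v}_k=\arg\min_{\mathbf{u}\in\mathcal{X}}\Big\{\sum_{i=0}^ka_i\langle\nabla f(\mathbf{x}_i),\mathbf{u}-\mathbf{x}_i\rangle+A_k\psi(\mathbf{u})+m_0\phi(\mathbf{u})\Big\}\quad(k\ge0),$$ $\mathbf{y}_0=\mathbf{v}_0$, and for $k\ge1$: $\mathbf{x}_k=\frac{A_{k-1}}{A_k}\mathbf{y}_{k-1}+\frac{a_k}{A_k}\mathbf{v}_{k-1}$, $\mathbf{y}_k=\frac{A_{k-1}}{A_k}\mathbf{y}_{k-1}+\frac{a_k}{A_k}\mathbf{v}_k$. Here $\phi$ is a function satisfying $\phi(\mathbf{u})\ge\frac1q\|\mathbf{u}-\mathbf{x}_0\|^q$ for all $\mathbf{u}$. For example, if $\lambda>0$, one can take $\phi(\mathbf{u})=\frac1\lambda D_\psi(\mathbf{u},\mathbf{x}_0)$, with $D_\psi$ the Bregman divergence of $\psi$. When $\lambda=0$, $\phi$ is taken to be $(1,q)$-uniformly convex w.r.t. $\|\cdot\|$. When $q=\kappa=2$, the factor $[\cdot]^{(q-\kappa)/\kappa}$ in $M_k$ is read as $1$.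
   Formalization: For λ>0, φ is also assumed (1,q)-uniformly convex unless a_k^q ≤ λA_{k-1}^q/M_k for all k≥1 (for merely convex φ the first bound fails); the O-bound is read as ε→0, with constant depending only on q, κ and an ε-threshold depending on L and φ(x̄* ). *)

(* Defs.v *)
From HB Require Import structures.
From mathcomp Require Import all_boot all_order all_algebra.
From mathcomp Require Import all_classical all_reals all_analysis.

Set Implicit Arguments.
Unset Strict Implicit.
Unset Printing Implicit Defensive.

Import Order.TTheory GRing.Theory Num.Theory.
Import numFieldNormedType.Exports.

Local Open Scope classical_set_scope.
Local Open Scope ring_scope.

(* psi and phi are extended-real-valued, so that they may encode constraints;
   being proper, they never take the value -oo. *)

Section Functions.
Context {R : realType} {E : normedModType R}.
Implicit Types (X : set E) (f : E -> R) (F : E -> \bar R).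

Definition finite_dimensional : Prop :=
  exists (n : nat) (b : 'I_n -> E),
    forall x, exists c : 'I_n -> R, x = \sum_(i < n) c i *: b i.

Definition dual_norm (l : E -> R) : R :=
  sup [set l u | u in [set u : E | `|u| <= 1]].

(* <grad f x, u> is 'd f x u. *)
Definition weakly_smooth (L kappa : R) f : Prop :=
  (forall x, differentiable f x) /\
  (forall x y, dual_norm (fun u => 'd f x u - 'd f y u)
               <= L * `|x - y| `^ (kappa - 1)).

Definition uniformly_convex (lam q : R) F : Prop :=
  forall (x y : E) (alpha : R), 0 < alpha -> alpha < 1 ->
    (F ((1 - alpha) *: x + alpha *: y)%R
     <= (1 - alpha)%:E * F x + alpha%:E * F y
        - (lam / q * (alpha * (1 - alpha)) * `|y - x| `^ q)%:E)%E.

Definition proper F : Prop :=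
  (forall x, F x != -oo%E) /\ (exists x, F x \is a fin_num).

Definition convex_efun F : Prop :=
  forall (x y : E) (alpha : R), 0 < alpha -> alpha < 1 ->
    (F ((1 - alpha) *: x + alpha *: y)%R
     <= (1 - alpha)%:E * F x + alpha%:E * F y)%E.

Definition proper_convex_lsc F : Prop :=
  [/\ proper F, convex_efun F & lower_semicontinuous F].

Definition is_argmin X F (v : E) : Prop :=
  X v /\ forall u, X u -> (F v <= F u)%E.

Definition composite f (psi : E -> \bar R) : E -> \bar R :=
  fun x => ((f x)%:E + psi x)%E.

Record composite_problem (q kappa L lam : R) X f (psi : E -> \bar R) : Prop :=
  CompositeProblem {
    problem_dim : finite_dimensional;
    problem_closed : closed X;
    problem_convex : convex_set X;
    problem_nonempty : X !=set0;
    problem_f_convex : convex_function setT f;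
    problem_f_smooth : weakly_smooth L kappa f;
    problem_psi : proper_convex_lsc psi;
    problem_psi_uc : uniformly_convex lam q psi }.

End Functions.

Section Algorithm.
Context {R : realType}.
Implicit Types (a delta : nat -> R).

Definition cumul a (k : nat) : R := \sum_(i < k.+1) a i.

(* For q = kappa = 2 the bracket is 0 and its exponent is 0; powR satisfies
   0 `^ 0 = 1, so the factor is then 1. *)
Definition smooth_const (q kappa L : R) delta (k : nat) : R :=
  (2 * (q - kappa) / (q * kappa * delta k)) `^ ((q - kappa) / kappa)
  * L `^ (q / kappa).

Definition step_max (q lam m0 : R) a (k : nat) : R :=
  Num.max (lam * cumul a k.-1 `^ q) (m0 * cumul a k `^ (q - 1)).

Context {E : normedModType R}.
Implicit Types (X : set E) (f : E -> R) (psi phi : E -> \bar R).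
Implicit Types (x v y : nat -> E).

Definition agd_objective f psi phi (m0 : R) a x (k : nat) (u : E) : \bar R :=
  ((\sum_(i < k.+1) a i * 'd f (x i) (u - x i))%:E
   + (cumul a k)%:E * psi u + m0%:E * phi u)%E.

Record agd_plus X f psi phi (m0 : R) a x v y : Prop := AgdPlus {
  agd_weights : forall k, 0 < a k;
  agd_init : X (x 0%N);
  agd_v : forall k, is_argmin X (agd_objective f psi phi m0 a x k) (v k);
  agd_y0 : y 0%N = v 0%N;
  agd_x : forall k, (1 <= k)%N ->
    x k = (cumul a k.-1 / cumul a k) *: y k.-1 + (a k / cumul a k) *: v k.-1;
  agd_y : forall k, (1 <= k)%N ->
    y k = (cumul a k.-1 / cumul a k) *: y k.-1 + (a k / cumul a k) *: v k }.

(* The last field: phi is (1, q)-uniformly convex, unless the first term of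
   the maximum alone already dominates M_k * a_k ^ q.  For lam = 0 the second
   alternative contradicts a_k > 0, so phi is then uniformly convex.  For
   lam > 0 the Bregman choice D_psi(., x0) / lam is (1, q)-uniformly convex;
   for a merely convex phi the term m0 * A_k ^ (q - 1) of the maximum cannot
   be used: the estimate fails for R, X = [-1, 1], x0 = 0, q = kappa = 2,
   phi u = max (1/2) (u^2/2), f u = (u - 9/10)^2/2, psi u = u^2/2000,
   lam = 1/1000, a_0 = 1, a_k maximal, all delta_i small, at k = 4. *)
Record regularizer (q lam : R) phi (x0 : E) a (M : nat -> R) : Prop :=
  Regularizer {
    regularizer_pcl : proper_convex_lsc phi;
    regularizer_ge : forall u, ((q^-1 * `|u - x0| `^ q)%:E <= phi u)%E;
    regularizer_uc : uniformly_convex 1 q phi \/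
      (forall k, (1 <= k)%N ->
        a k `^ q <= lam * cumul a k.-1 `^ q / M k) }.

(* Everything except the condition relating a_k to the maximum. *)
Record agd_setting (q kappa L lam : R) X f psi phi (xstar : E) (m0 : R)
    a delta x v y : Prop := AgdSetting {
  setting_problem : composite_problem q kappa L lam X f psi;
  setting_argmin : is_argmin X (composite f psi) xstar;
  setting_regularizer :
    regularizer q lam phi (x 0%N) a (smooth_const q kappa L delta);
  setting_agd : agd_plus X f psi phi m0 a x v y;
  setting_delta : forall k, 0 < delta k;
  setting_m0 : cumul a 0 * smooth_const q kappa L delta 0 = m0 }.

End Algorithm.

(* For lam = 0 the first quantity of the minimum is infinite.  For Phi = 0 the
   second one is 0, and so is the first by the convention ln 0 = 0. *)
Definition iteration_bound (R : realType) (q kappa L lam Phi eps : R) : R :=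
  let D := q * kappa - q + kappa in
  let B1 := (1 / eps) `^ ((q - kappa) / D)
            * Num.max (L `^ (q / kappa) / lam) 1 `^ (kappa / D)
            * ln (L * Phi / eps) in
  let B2 := (L / eps) `^ (q / D) * Phi `^ (kappa / D) in
  if lam == 0 then B2 else Num.min B1 B2.

(* Main.v *)
Require Import Defs.
From HB Require Import structures.
From mathcomp Require Import all_boot all_order all_algebra.
From mathcomp Require Import all_classical all_reals all_analysis.
From mathcomp Require Import ring lra.
Import Order.TTheory GRing.Theory Num.Theory.
Import numFieldNormedType.Exports.
Local Open Scope classical_set_scope.
Local Open Scope ring_scope.

(** The estimate is a primal-dual one. Let P_k be the sum of a_i f(x_i), i <= k,
    plus the minimal value of the k-th objective. Evaluating that objective at
    xstar instead of v_k, and bounding each linearization of the convex f by f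
    itself, gives P_k <= A_k fbar(xstar) + m0 phi(xstar)  ([agd_gap]).
    In the other direction, A_k fbar(y_k) <= P_k + (1/2) sum_i A_i delta_i
    ([agd_upper_bound]), by induction on k. The difference of the two bounds is
    the announced gap.

    The induction step compares the gain and the loss along w = v_k - v_(k-1).
    Weak smoothness gives a descent inequality with remainder
    (L/kappa) |.|^kappa ([weakly_smooth_le]); Young's inequality trades it for
    (M_k/q) |.|^q + delta_k/2 ([power_le_smooth_const]), and M_k is precisely
    the constant this produces. Since y_k - x_k = (a_k/A_k) w, the loss is
    A_k (M_k/q) (a_k/A_k)^q |w|^q. The previous objective is uniformly convex
    with modulus A_(k-1) lam + m0 sigma, where sigma is 1 or 0 according to
    whether phi is known to be uniformly convex, so moving from its minimizer
    v_(k-1) to v_k gains that modulus times |w|^q / q ([argmin_growth]). The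
    condition on a_k says that the gain covers the loss
    ([step_condition_modulus]).

    For delta_k = (a_k/A_k) eps the gap is m0 Phi / A_k + eps/2, so it suffices
    that A_k reaches 2 m0 Phi / eps, the [target]. Then M_k is m0 (A_k/a_k)^r
    with r = (q - kappa)/kappa, and the equality defining a_k yields two
    recursions for A_k ([maximal_step]), with s = q - r > 1:
    - a_k^s >= A_k^(s-1): by Bernoulli's inequality A_k^(1/s) increases by at
      least 1/s at each step, so A_k >= (k/s)^s ([polynomial_growth]);
    - t^s (1+t)^r >= lam/m0 for t = a_k/A_(k-1): hence, if lam > 0, t is at
      least some tau in (0,1], and A_k >= (1+tau)^k >= exp(k tau/2)
      ([geometric_growth]).
    Solving for k gives the two terms of the minimum; the constants and the
    rounding up are absorbed once eps is small, uniformly in lam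
    ([iterations_le_bound]). *)

(** * Smooth convex functions *)

Section DualNorm.
Context {R : realType} {E : normedModType R}.

(** The supremum defining the dual norm is finite because a continuous linear
    form is bounded on the unit ball; the value of sup at an unbounded set is 0,
    which would bound nothing. *)
Lemma le_dual_norm (l : {linear E -> R}) (u : E) :
  continuous l -> l u <= dual_norm l * `|u|.
Proof.
move=> cl.
have bnd : has_ubound [set l u | u in [set u : E | `|u| <= 1]].
  have /linear_boundedP : bounded_near l (nbhs (0 : E)).
    by apply: continuous_linear_bounded; exact: cl.
  move=> /pinfty_ex_gt0[r r0 /= lr]; exists r => _ [w /= w1 <-].
  rewrite (le_trans (ler_norm _))// (le_trans (lr w))//.
  by rewrite -[leRHS]mulr1 ler_pM2l.
have [->|u0] := eqVneq u 0; first by rewrite linear0 normr0 mulr0.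
have nu : 0 < `|u| by rewrite normr_gt0.
rewrite -ler_pdivrMr// mulrC -[_^-1 * _]/(_^-1 *: (_ : R^o)) -linearZ.
apply: ub_le_sup => //; exists (`|u|^-1 *: u) => //=.
by rewrite normrZ ger0_norm ?invr_ge0// mulVf ?gt_eqF.
Qed.

End DualNorm.

Section Smooth.
Context {R : realType} {E : normedModType R}.

Lemma is_derive_line (f : E -> R) (x w : E) (t : R) :
  differentiable f (x + t *: w) ->
  is_derive t 1 (fun s : R => f (x + s *: w)) ('d f (x + t *: w) w).
Proof.
move=> df.
pose g := fun s : R => x + s *: w.
have dg : is_diff t g (0 + ( *:%R ^~ w)) by exact: is_diffD.
have [dgt eg] := dg.
have dfg : differentiable (f \o g) t by exact: differentiable_comp.
apply: DeriveDef; first exact: diff_derivable.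
have e : 'd (f \o g) t = 'd f (g t) \o 'd g t :> (_ -> _) by exact: diff_comp.
by rewrite deriveE// -/(f \o g) e /= eg !fctE scale1r add0r.
Qed.

(** The difference quotients of a convex function along y - x are bounded by
    f y - f x; the derivative is their limit. *)
Lemma convex_tangent_le (f : E -> R) (x y : E) :
  convex_function setT f -> differentiable f x ->
  f x + 'd f x (y - x) <= f y.
Proof.
move=> cf df.
rewrite -lerBrDl -deriveE//.
have dfx : derivable f x (y - x) by exact: diff_derivable.
apply: (cvgr_to_le (cvg_dnbhs_at_right dfx)).
near=> h.
have h0 : 0 < h by [].
have h1 : h < 1 by near: h; exact: nbhs_right_lt.
rewrite -[_ *: _]/(_ * _) ler_pdivrMl//=.
have fh : f (h *: y + (1 - h) *: x) <= h * f y + (1 - h) * f x.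
  exact: (cf (Itv01 (ltW h0) (ltW h1)) y x (in_setT _) (in_setT _)).
have -> : h *: (y - x) + x = h *: y + (1 - h) *: x.
  by rewrite scalerBr scalerBl scale1r -!addrA [- _ + x]addrC.
lra.
Unshelve. all: by end_near.
Qed.

(** The constant L/kappa is the integral of L t^(kappa-1) over [0,1]. Integration
    is avoided by showing that the difference of the two sides, as a function of
    the position t on the segment, is nonincreasing. *)
Lemma weakly_smooth_le (f : E -> R) (L kappa : R) (x y : E) :
  1 < kappa -> 0 < L -> weakly_smooth L kappa f ->
  f y <= f x + 'd f x (y - x) + L / kappa * `|y - x| `^ kappa.
Proof.
move=> kappa_gt1 L0 [df dL].
have k0 : 0 < kappa by lra.
set w := y - x; set N := `|w| `^ kappa.
pose h (t : R) := f (x + t *: w) - (t * 'd f x w + L / kappa * N * t `^ kappa).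
have dh (t : R) : 0 < t -> is_derive t 1 h
    ('d f (x + t *: w) w - ('d f x w + L * N * t `^ (kappa - 1))).
  move=> t0.
  apply: is_deriveB; first exact: is_derive_line.
  apply: is_deriveD.
    have -> : (fun s => s * 'd f x w) = 'd f x w \*: (id : R -> R).
      by apply/funext => s; rewrite mulrC.
    by apply: is_derive_eq; rewrite -[_ *: _]/(_ * _) mulr1.
  have -> : (fun s => L / kappa * N * s `^ kappa) =
      (L / kappa * N) \*: (fun s : R => s `^ kappa) by apply/funext => s.
  have ? := is_derive1_powR kappa t0.
  by apply: is_derive_eq; rewrite -[_ *: _]/(_ * _); field; rewrite gt_eqF.
suff : h 1 <= h 0.
  rewrite /h scale1r scale0r addr0 powR1 powR0 ?gt_eqF// /w subrKC. lra.
have ch : {within `[0, 1], continuous h}.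
  apply/continuous_within_itvP => //; split.
  - move=> t; rewrite in_itv/= => /andP[t0 _].
    have [dt _] := dh _ t0.
    exact/differentiable_continuous/derivable1_diffP.
  (* Only one-sided continuity holds at 0: t `^ kappa is 1 for negative t. *)
  - have [d0 _] : is_derive (0 : R) 1 (fun s : R => f (x + s *: w)) ('d f (x + 0 *: w) w).
      exact: is_derive_line.
    rewrite /h; apply: cvgB.
      apply: cvg_at_right_filter.
      exact/differentiable_continuous/derivable1_diffP.
    apply: cvgD.
      apply: cvg_at_right_filter.
      by apply: cvgM; [exact: cvg_id | exact: cvg_cst].
    apply: cvgM; first exact: cvg_cst.
    by rewrite powR0 ?gt_eqF//; exact: powR_cvg0.
  - apply: cvg_at_left_filter.
    have [dt _] := dh _ ltr01.
    exact/differentiable_continuous/derivable1_diffP.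
apply: (ler0_derive1_nincr _ _ ch) => // t; rewrite in_itv/= => /andP[t0 t1].
  by have [] := dh _ t0.
rewrite derive1E (@derive_val _ _ _ _ _ _ _ (dh _ t0)).
have := @le_dual_norm _ _ ('d f (x + t *: w) \- 'd f x) w.
have cl : continuous ('d f (x + t *: w) \- 'd f x).
  move=> z; apply: cvgB; exact: diff_continuous.
move=> /(_ cl) /= dw.
have := dL (x + t *: w) x.
rewrite addrAC subrr add0r normrZ gtr0_norm// powRM ?(ltW t0)// => dL'.
have dN : `|w| `^ (kappa - 1) * `|w| = N.
  by rewrite mulrC mulr_powRB1.
have := le_trans dw (ler_wpM2r (normr_ge0 w) dL').
by rewrite subr_le0 -dN -lerBlDl => /le_trans; apply; lra.
Qed.

End Smooth.

(** * From exponent kappa to exponent q *)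

Section Young.
Context {R : realType}.

Lemma powRV (x r : R) : 0 < x -> x^-1 `^ r = (x `^ r)^-1.
Proof. by move=> x0; rewrite -powR_inv1 ?ltW// -powRrM mulN1r powRN. Qed.

Lemma smooth_const_gt0 (q kappa L : R) (delta : nat -> R) (k : nat) :
  0 < kappa -> kappa <= q -> 0 < L -> 0 < delta k ->
  0 < smooth_const q kappa L delta k.
Proof.
move=> k0 kq L0 d0; rewrite /smooth_const mulr_gt0 ?(powR_gt0 _ L0)//.
have [->|nkq] := eqVneq q kappa; first by rewrite subrr mul0r powRr0.
have q0 := lt_le_trans k0 kq.
have kq' : 0 < q - kappa by rewrite subr_gt0 lt_neqAle eq_sym nkq.
by rewrite powR_gt0// divr_gt0// !mulr_gt0.
Qed.

(** Young's inequality u b <= u^p / p + b^p' / p' with p = q/kappa, for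
    u = L t^kappa / (kappa b) and the b such that b^p' / p' = delta_k / 2; the
    other term is then exactly the first one on the right. *)
Lemma power_le_smooth_const (q kappa L t : R) (delta : nat -> R) (k : nat) :
  0 < kappa -> kappa <= q -> 0 < L -> 0 < delta k -> 0 <= t ->
  L / kappa * t `^ kappa
    <= smooth_const q kappa L delta k / q * t `^ q + delta k / 2.
Proof.
move=> k0 kq L0; rewrite /smooth_const; set d := delta k => d0 t0.
have [->|nkq] := eqVneq q kappa.
  rewrite subrr !mul0r powRr0 mul1r divff ?gt_eqF// powRr1 ?ltW//.
  lra.
have q0 := lt_le_trans k0 kq.
have kq' : 0 < q - kappa by rewrite subr_gt0 lt_neqAle eq_sym nkq.
set p := q / kappa; set p' := q / (q - kappa); set r := (q - kappa) / kappa.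
have p0 : 0 < p by rewrite divr_gt0.
have p'0 : 0 < p' by rewrite divr_gt0.
have pp' : p^-1 + p'^-1 = 1.
  by rewrite /p /p'; field; rewrite ?gt_eqF//=.
pose b0 := d * q / (2 * (q - kappa)).
have b00 : 0 < b0 by rewrite /b0 divr_gt0 ?mulr_gt0.
pose b := b0 `^ p'^-1.
have bgt0 : 0 < b by rewrite powR_gt0.
have ht : 0 <= t `^ kappa by rewrite powR_ge0.
have a0 : 0 <= L / kappa / b * t `^ kappa.
  by rewrite mulr_ge0// ltW// !divr_gt0.
have := conjugate_powR a0 (ltW bgt0) p0 p'0 pp'.
have -> : L / kappa / b * t `^ kappa * b = L / kappa * t `^ kappa.
  by field; rewrite ?gt_eqF.
move/le_trans; apply.
have -> : b `^ p' / p' = d / 2.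
  rewrite /b -powRrM mulVf ?gt_eqF// powRr1 ?ltW// /b0 /p'.
  by field; rewrite ?gt_eqF.
rewrite lerD2r le_eqVlt; apply/orP; left; apply/eqP.
rewrite powRM//; last by rewrite ltW// !divr_gt0.
rewrite -powRrM.
have -> : kappa * p = q by rewrite /p; field; rewrite gt_eqF.
have -> : (L / kappa / b) `^ p = L `^ p * (kappa `^ p)^-1 * (b `^ p)^-1.
  rewrite powRM ?invr_ge0 ?(ltW bgt0)//; last by rewrite ltW// divr_gt0.
  by rewrite powRM ?invr_ge0 ?ltW// !powRV.
have -> : (b `^ p)^-1 = (b0^-1) `^ r.
  rewrite /b -powRrM powRV//; congr (_ `^ _)^-1.
  by rewrite /p /p' /r; field; rewrite ?gt_eqF.
have -> : 2 * (q - kappa) / (q * kappa * d) = b0^-1 / kappa.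
  by rewrite /b0; field; rewrite ?gt_eqF.
have kp : kappa `^ p = kappa * kappa `^ r.
  rewrite -{2}[kappa]powRr1 ?ltW// -powRD ?(gt_eqF k0) ?implybT//.
  by congr (_ `^ _); rewrite /p /r; field; rewrite ?gt_eqF.
rewrite powRM ?invr_ge0 ?ltW// (powRV _ r k0) kp /p.
have kr : kappa `^ r != 0 by rewrite gt_eqF ?powR_gt0.
by field; rewrite kr ?gt_eqF.
Qed.

End Young.

(** * Uniformly convex extended-valued functions *)

Section UniformConvexity.
Context {R : realType} {E : normedModType R}.
Implicit Types (F G : E -> \bar R) (q lam mu : R).

Lemma convex_uniformly_convex0 q F : convex_efun F -> uniformly_convex 0 q F.
Proof. by move=> cF x y t t0 t1; rewrite !mul0r sube0; exact: cF. Qed.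

Lemma uniformly_convex_affine q (h : E -> R) :
  (forall x y t, h ((1 - t) *: x + t *: y) = (1 - t) * h x + t * h y) ->
  uniformly_convex 0 q (EFin \o h).
Proof.
by move=> hE x y t t0 t1; rewrite !mul0r sube0 -!EFinM -EFinD lee_fin hE.
Qed.

(** Excluding the value -oo makes multiplication by a scalar distribute over
    the sum. *)
Lemma uniformly_convexD q lam mu F G :
  (forall x, F x != -oo%E) -> (forall x, G x != -oo%E) ->
  uniformly_convex lam q F -> uniformly_convex mu q G ->
  uniformly_convex (lam + mu) q (fun u => F u + G u)%E.
Proof.
move=> Fn Gn ucF ucG x y t t0 t1.
have mulD (s : R) u : (s%:E * (F u + G u) = s%:E * F u + s%:E * G u)%E.
  by rewrite muleDr// ltninfty_adde_def// inE/= ltNye.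
apply: (le_trans (leeD (ucF _ _ _ t0 t1) (ucG _ _ _ t0 t1))).
rewrite !mulD [leLHS]addeACA [X in (X + _)%E]addeACA -EFinN -EFinN -EFinD -EFinN.
by rewrite leeD2l// lee_fin; lra.
Qed.

Lemma mule_neqNy (c : R) (z : \bar R) :
  0 < c -> (z != -oo -> c%:E * z != -oo)%E.
Proof. by move=> c0; case: z => [r| |]//; rewrite gt0_muley. Qed.

Lemma uniformly_convexZ q lam (c : R) F :
  0 < c -> (forall x, F x != -oo%E) -> uniformly_convex lam q F ->
  uniformly_convex (c * lam) q (fun u => c%:E * F u)%E.
Proof.
move=> c0 Fn ucF x y t t0 t1.
have := lee_wpmul2l _ (ucF x y t t0 t1).
move=> /(_ c%:E); rewrite lee_fin => /(_ (ltW c0))/le_trans; apply.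
have nF (s : R) u : 0 < s -> (s%:E * F u != -oo)%E.
  by move=> s0; exact: mule_neqNy.
have nDF : ((1 - t)%:E * F x + t%:E * F y != -oo)%E.
  by rewrite adde_eq_ninfty negb_or !nF ?subr_gt0.
rewrite muleBr ?fin_num_adde_defl// muleDr//; last first.
  by rewrite ltninfty_adde_def// inE/= ltNye nF// subr_gt0.
rewrite !muleA ![(c%:E * _%:E)%E]muleC -EFinM.
apply: leeD => //; rewrite lee_fin; lra.
Qed.

(** Comparing the minimum with the value at (1-t) v + t u gives the bound with
    the factor 1 - t on the modulus; then t tends to 0. *)
Lemma argmin_growth q mu (X : set E) F (v u : E) :
  0 < q -> 0 <= mu -> convex_set X -> is_argmin X F v -> X u -> F v \is a fin_num ->
  uniformly_convex mu q F ->
  (F v + (mu / q * `|u - v| `^ q)%:E <= F u)%E.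
Proof.
move=> q0 mu0 cX [Xv minv] Xu Fv ucF.
have := minv u Xu.
case Fu : (F u) => [r| |]; last 2 first.
- by move=> _; rewrite leey.
- by rewrite leeNy_eq => /eqP Fve; rewrite Fve in Fv.
move: Fv; case Fve : (F v) => [s| |]// _ _.
rewrite -EFinD lee_fin.
set W := mu / q * _.
suff : forall t : R, 0 < t -> t < 1 -> s + (1 - t) * W <= r.
  move=> H.
  rewrite leNgt; apply/negP => rsW.
  have W0 : 0 <= W by rewrite mulr_ge0 ?powR_ge0// divr_ge0// ltW.
  have [sr|sr] := leP s r; last by have := H (1/2); lra.
  have W1 : 0 < W by lra.
  (* Were s + W > r, this t would make (1 - t) W exceed r - s by half of the
     excess. *)
  pose t := (s + W - r) / (2 * W).
  have t0 : 0 < t by rewrite divr_gt0//; lra.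
  have t1 : t < 1 by rewrite ltr_pdivrMr; lra.
  have := H t t0 t1; rewrite mulrBl mul1r.
  have -> : t * W = (s + W - r) / 2 by rewrite /t; field; rewrite gt_eqF.
  lra.
move=> t t0 t1.
have Xt : X ((1 - t) *: v + t *: u).
  have := cX u v (Itv01 (ltW t0) (ltW t1)) (mem_set Xu) (mem_set Xv).
  by rewrite inE addrC.
have := le_trans (minv _ Xt) (ucF v u t t0 t1).
rewrite Fu Fve -!EFinM -!EFinD lee_fin => H.
have : t * (s + (1 - t) * W) <= t * r by rewrite /W; nra.
by rewrite ler_pM2l.
Qed.

End UniformConvexity.

(** * The primal-dual estimate *)

Section Weights.
Context {R : realType} (a : nat -> R) (a_gt0 : forall k, 0 < a k).

Lemma cumulS k : cumul a k.+1 = cumul a k + a k.+1.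
Proof. by rewrite /cumul big_ord_recr. Qed.

Lemma cumul0 : cumul a 0 = a 0%N.
Proof. by rewrite /cumul big_ord1. Qed.

Lemma cumul_gt0 k : 0 < cumul a k.
Proof.
by elim: k => [|k IH]; rewrite ?cumul0// cumulS addr_gt0.
Qed.

End Weights.

Section Estimate.
Context {R : realType} {E : normedModType R}.
Implicit Types (f : E -> R) (psi phi : E -> \bar R) (a : nat -> R).
Implicit Types (x v y : nat -> E).

Lemma agd_objective_fin_num f psi phi m0 a x k u :
  0 < m0 -> 0 < cumul a k -> psi u != -oo%E -> phi u != -oo%E ->
  (agd_objective f psi phi m0 a x k u \is a fin_num)
    = (psi u \is a fin_num) && (phi u \is a fin_num).
Proof.
move=> m00 A0; rewrite /agd_objective.
by case: (psi u) => [r| |]//; case: (phi u) => [s| |]//; rewrite ?gt0_muley ?lte_fin.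
Qed.

(** The linear part contributes nothing; A_k psi and m0 phi add their moduli. *)
Lemma uniformly_convex_agd_objective f psi phi m0 a x k q lam sigma :
  0 < m0 -> 0 < cumul a k -> Defs.proper psi -> Defs.proper phi ->
  uniformly_convex lam q psi -> uniformly_convex sigma q phi ->
  uniformly_convex (cumul a k * lam + m0 * sigma) q
    (agd_objective f psi phi m0 a x k).
Proof.
move=> m00 A0 [psiN _] [phiN _] ucpsi ucphi.
have aff : uniformly_convex 0 q
    (EFin \o fun u => \sum_(i < k.+1) a i * 'd f (x i) (u - x i)).
  apply: uniformly_convex_affine => u w t.
  rewrite !mulr_sumr -big_split/=; apply: eq_bigr => i _.
  have -> : (1 - t) *: u + t *: w - x i = (1 - t) *: (u - x i) + t *: (w - x i).
    by rewrite !scalerBr addrACA -opprD -scalerDl subrK scale1r.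
  have dZ (s : R) z : 'd f (x i) (s *: z) = s * 'd f (x i) z by exact: linearZ.
  by rewrite linearD !dZ; ring.
have ucA : uniformly_convex (0 + cumul a k * lam) q (fun u =>
    (\sum_(i < k.+1) a i * 'd f (x i) (u - x i))%:E + (cumul a k)%:E * psi u)%E.
  apply: (uniformly_convexD _ _ _ _ _ _ _ aff) => //.
    by move=> u; exact: mule_neqNy.
  exact: uniformly_convexZ.
rewrite add0r in ucA.
apply: (uniformly_convexD _ _ _ _ _ _ _ ucA).
- by move=> u; rewrite adde_eq_ninfty negb_or /= mule_neqNy.
- by move=> u; exact: mule_neqNy.
- exact: uniformly_convexZ.
Qed.

Context (q kappa L lam m0 sigma : R) (X : set E) (f : E -> R).
Context (psi phi : E -> \bar R) (xstar : E) (a delta : nat -> R).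
Context (x v y : nat -> E).
Let M := smooth_const q kappa L delta.

(** The right-hand side is the dual quantity P_k plus the accumulated errors.
    The hypothesis on [M k.+1] is what makes the growth of the k-th objective
    between [v k] and [v k.+1] pay for the remainder of the descent inequality
    between [x k.+1] and [y k.+1]. The base case uses instead that phi u is at
    least |u - x_0|^q / q. *)
Lemma agd_upper_bound :
  2 <= q -> 1 < kappa -> kappa <= 2 -> 0 < L -> 0 <= lam -> 0 <= sigma ->
  agd_setting q kappa L lam X f psi phi xstar m0 a delta x v y ->
  uniformly_convex sigma q phi ->
  (forall k, M k.+1 * a k.+1 `^ q <=
     (cumul a k * lam + m0 * sigma) * cumul a k.+1 `^ (q - 1)) ->
  psi xstar \is a fin_num -> phi xstar \is a fin_num ->
  forall k,
   ((cumul a k)%:E * composite f psi (y k) <=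
    (\sum_(i < k.+1) a i * f (x i))%:E + agd_objective f psi phi m0 a x k (v k)
     + ((\sum_(i < k.+1) cumul a i * delta i) / 2)%:E)%E.
Proof.
move=> q_ge2 kappa_gt1 kappa_le2 L0 lam0 sigma0 S ucphi stepM psis phis.
have [[_ _ cX _ cf [df sf] [[psiN psi0] _ _] ucpsi] [Xstar _]
  [[[phiN phi0] _ _] phige _] agd d0 m0E] := S.
have ws : weakly_smooth L kappa f by [].
have [a0 Xx0 argv y0 xE yE] := agd.
have q0 : 0 < q by lra.
have kq : kappa <= q by lra.
have k0 : 0 < kappa by lra.
have A0 := cumul_gt0 _ a0.
have M0 k : 0 < M k by exact: smooth_const_gt0.
have m00 : 0 < m0 by rewrite -m0E mulr_gt0.
have descent z w k : f w <= f z + 'd f z (w - z) + (M k / q * `|w - z| `^ q + delta k / 2).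
  apply: (le_trans (weakly_smooth_le f L kappa z w kappa_gt1 L0 ws)).
  by rewrite lerD2l; exact: power_le_smooth_const.
pose lin k u := \sum_(i < k.+1) a i * 'd f (x i) (u - x i).
have objE k u p r : psi u = p%:E -> phi u = r%:E ->
    agd_objective f psi phi m0 a x k u = (lin k u + cumul a k * p + m0 * r)%:E.
  by rewrite /agd_objective => -> ->.
have objf k : agd_objective f psi phi m0 a x k (v k) \is a fin_num.
  rewrite fin_numE; apply/andP; split.
  - rewrite /agd_objective !adde_eq_ninfty/= negb_or.
    by rewrite !mule_neqNy.
  - rewrite -ltey; apply: (le_lt_trans ((argv k).2 xstar Xstar)).
    by rewrite ltey_eq agd_objective_fin_num// psis phis.
have finv k : (psi (v k) \is a fin_num) && (phi (v k) \is a fin_num).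
  by rewrite -(agd_objective_fin_num f psi phi m0 a x k _ m00 (A0 k)).
have psiv k : psi (v k) = (fine (psi (v k)))%:E.
  by rewrite fineK//; have /andP[] := finv k.
have phiv k : phi (v k) = (fine (phi (v k)))%:E.
  by rewrite fineK//; have /andP[] := finv k.
move: psiv phiv; set ps := fun k => fine (psi (v k)); set ph := fun k => fine (phi (v k)).
rewrite -/(ps _) -/(ph _) => psiv phiv.
suff H k : exists2 p, psi (y k) = p%:E &
  cumul a k * (f (y k) + p) <= \sum_(i < k.+1) a i * f (x i)
    + (lin k (v k) + cumul a k * ps k + m0 * ph k)
    + (\sum_(i < k.+1) cumul a i * delta i) / 2.
  move=> k; have [p yp pb] := H k.
  by rewrite (objE _ _ _ _ (psiv k) (phiv k)) /composite yp -!EFinD -EFinM lee_fin.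
elim: k => [|k [p yp IH]].
  exists (ps 0%N); first by rewrite y0.
  rewrite y0 /lin !big_ord1 cumul0.
  have := descent (x 0%N) (v 0%N) 0%N.
  have := phige (v 0%N); rewrite phiv lee_fin.
  move: m0E; rewrite cumul0 -/(M 0) => <-.
  move: (a0 0%N).
  set N := _ `^ q => a00 h1 h2.
  have := ler_wpM2l (ltW a00) h2.
  have : a 0%N * M 0 * (q^-1 * N) <= a 0%N * M 0 * ph 0%N by rewrite ler_pM2l// mulr_gt0.
  nra.
have Ak := cumulS a k; set B := cumul a k in Ak IH *; set A := cumul a k.+1 in Ak *.
set al := a k.+1 in Ak *.
have al0 : 0 < al by exact: a0.
have B0 : 0 < B by exact: A0.
have AB0 : 0 < A by exact: A0.
pose t := al / A.
have t0 : 0 < t by rewrite divr_gt0.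
have t1 : t < 1 by rewrite ltr_pdivrMr// mul1r Ak ltrDr.
have tB : B / A = 1 - t by rewrite /t Ak; field; rewrite -Ak gt_eqF.
have ykE : y k.+1 = (1 - t) *: y k + t *: v k.+1 by rewrite yE//= -tB.
have xkE : x k.+1 = (1 - t) *: y k + t *: v k by rewrite xE//= -tB.
have := ucpsi (y k) (v k.+1) t t0 t1.
rewrite -ykE yp psiv -!EFinM -!EFinD.
have := psiN (y k.+1).
case: (psi (y k.+1)) => [py _| |]//; rewrite lee_fin => psiy.
exists py => //.
set w := v k.+1 - v k.
have ywE : y k.+1 - x k.+1 = t *: w.
  by rewrite ykE xkE opprD addrACA subrr add0r -scalerBr.
pose W := `|w| `^ q.
have W0 : 0 <= W by rewrite powR_ge0.
(* The gain: [v k] minimizes the k-th objective. *)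
have grow : lin k (v k) + B * ps k + m0 * ph k + (B * lam + m0 * sigma) / q * W
    <= lin k (v k.+1) + B * ps k.+1 + m0 * ph k.+1.
  have mu0 : 0 <= B * lam + m0 * sigma.
    by rewrite addr_ge0 ?mulr_ge0// ltW.
  have uc := uniformly_convex_agd_objective f psi phi m0 a x k q lam sigma m00 B0
    (conj psiN psi0) (conj phiN phi0) ucpsi ucphi.
  have := argmin_growth q _ X _ (v k) (v k.+1) q0 mu0 cX (argv k) (argv k.+1).1
    (objf k) uc.
  by rewrite (objE _ _ _ _ (psiv k) (phiv k)) (objE _ _ _ _ (psiv k.+1) (phiv k.+1))
    -EFinD lee_fin.
have cvx := convex_tangent_le f (x k.+1) (y k) cf (df _).
have desc := descent (x k.+1) (y k.+1) k.+1.
set g := 'd f (x k.+1) in cvx desc.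
(* Measured from [x k.+1], the linear term at [y k.+1] splits over the two points
   that [y k.+1] combines, with the weights B and al. *)
have gE : A * g (y k.+1 - x k.+1) = B * g (y k - x k.+1) + al * g (v k.+1 - x k.+1).
  have -> : y k.+1 - x k.+1 = (1 - t) *: (y k - x k.+1) + t *: (v k.+1 - x k.+1).
    by rewrite ykE !scalerBr addrACA -opprD -scalerDl subrK scale1r.
  have gZ (s : R) z : g (s *: z) = s * g z by exact: linearZ.
  by rewrite linearD !gZ -tB /t; field; rewrite gt_eqF.
(* The loss, covered by the gain. *)
have NE : A * (M k.+1 / q * `|y k.+1 - x k.+1| `^ q) <= (B * lam + m0 * sigma) / q * W.
  rewrite ywE normrZ gtr0_norm// powRM ?(ltW t0)// -/W.
  rewrite [leRHS]mulrAC [leLHS](_ : _ = A * M k.+1 * t `^ q * W / q); last by ring.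
  rewrite ler_pM2r ?invr_gt0// ler_wpM2r//.
  have -> : t `^ q = al `^ q / A `^ q by rewrite /t powRM ?invr_ge0 ?ltW// powRV.
  have Aq : A * A `^ (q - 1) = A `^ q by rewrite mulr_powRB1 ?ltW.
  have pA : 0 < A `^ (q - 1) by exact: powR_gt0.
  rewrite -Aq [leLHS](_ : _ = M k.+1 * al `^ q / A `^ (q - 1)); last first.
    by field; rewrite !gt_eqF.
  by rewrite ler_pdivrMr// stepM.
have lins u : lin k.+1 u = lin k u + al * g (u - x k.+1) by rewrite /lin big_ord_recr.
rewrite big_ord_recr [X in _ <= _ + X / 2]big_ord_recr /= lins -/A -/al.
have psiA : A * py <= B * p + al * ps k.+1.
  have lq0 : 0 <= lam / q * (t * (1 - t)) * `|v k.+1 - y k| `^ q.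
    by rewrite !mulr_ge0 ?powR_ge0 ?invr_ge0 ?subr_ge0//; exact: ltW.
  have : A * py <= A * ((1 - t) * p + t * ps k.+1).
    by rewrite ler_pM2l// (le_trans psiy)// gerBl.
  by rewrite -tB /t; congr (_ <= _); field; rewrite gt_eqF.
have := ler_wpM2l (ltW AB0) desc.
have := ler_wpM2l (ltW B0) cvx.
rewrite !mulrDr gE.
have -> : A * f (x k.+1) = B * f (x k.+1) + al * f (x k.+1) by rewrite Ak mulrDl.
have -> : A * ps k.+1 = B * ps k.+1 + al * ps k.+1 by rewrite Ak mulrDl.
move: NE IH grow; rewrite mulrDr.
lra.
Qed.

End Estimate.

Section Gap.
Context {R : realType} {E : normedModType R}.
Context (q kappa L lam m0 : R) (X : set E) (f : E -> R).
Context (psi phi : E -> \bar R) (xstar : E) (a delta : nat -> R).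
Context (x v y : nat -> E).
Context (q_ge2 : 2 <= q) (kappa_gt1 : 1 < kappa) (kappa_le2 : kappa <= 2).
Context (L0 : 0 < L) (lam0 : 0 <= lam).
Let M := smooth_const q kappa L delta.

(** With sigma = 1 either term of the maximum is below the total modulus, since
    A_k <= A_(k+1). With sigma = 0 only the term in lam may be used, which is the
    second alternative for the regularizer. *)
Lemma step_condition_modulus :
  agd_setting q kappa L lam X f psi phi xstar m0 a delta x v y ->
  (forall k, (1 <= k)%N -> a k `^ q <= step_max q lam m0 a k / M k) ->
  exists sigma : R, [/\ 0 <= sigma, uniformly_convex sigma q phi &
    forall k, M k.+1 * a k.+1 `^ q <=
     (cumul a k * lam + m0 * sigma) * cumul a k.+1 `^ (q - 1)].
Proof.
have [k0 kq q1] : [/\ 0 < kappa, kappa <= q & 0 < q - 1].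
  by move: q_ge2 kappa_gt1 kappa_le2 => *; split; lra.
move=> [_ _ [[_ phic _] _ phiuc] agd d0 m0E] step.
have a0 := agd_weights agd.
have A0 := cumul_gt0 _ a0.
have M0 k : 0 < M k by exact: smooth_const_gt0.
have m00 : 0 < m0 by rewrite -m0E mulr_gt0.
have lamA k : lam * cumul a k `^ q <= cumul a k * lam * cumul a k.+1 `^ (q - 1).
  rewrite -mulr_powRB1 ?(ltW (A0 k))//; last by move: q1; lra.
  rewrite mulrA (mulrC lam) ler_wpM2l ?mulr_ge0 ?(ltW (A0 k))//.
  rewrite ge0_ler_powR ?nnegrE ?(ltW (A0 _))//; first exact: ltW.
  by rewrite cumulS lerDl ltW.
have pA k : 0 <= cumul a k `^ (q - 1) by exact: powR_ge0.
case: phiuc => [uc1|big].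
  exists 1; split => // k.
  have := step k.+1 isT; rewrite ler_pdivlMr// mulrC => /le_trans; apply.
  rewrite /step_max /= mulr1 mulrDl ge_max; apply/andP; split.
    by rewrite (le_trans (lamA k))// lerDl mulr_ge0// ltW.
  by rewrite lerDr !mulr_ge0// ltW.
exists 0; split => //; first exact: convex_uniformly_convex0.
move=> k; rewrite mulr0 addr0 (le_trans _ (lamA k))//.
by have := big k.+1 isT; rewrite ler_pdivlMr// mulrC.
Qed.

(** If psi is infinite at xstar, the left-hand side is -oo; if phi is, the
    right-hand side is +oo. Otherwise [agd_upper_bound] is combined with the
    lower estimate from the value of the objective at xstar. *)
Lemma agd_gap :
  agd_setting q kappa L lam X f psi phi xstar m0 a delta x v y ->
  (forall k, (1 <= k)%N -> a k `^ q <= step_max q lam m0 a k / M k) ->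
  forall k,
    (composite f psi (y k) - composite f psi xstar
       <= ((2 * cumul a 0 * M 0%N)%:E * phi xstar
           + (\sum_(i < k.+1) cumul a i * delta i)%:E)
          * ((2 * cumul a k)^-1)%:E)%E.
Proof.
have [k0 kq q1] : [/\ 0 < kappa, kappa <= q & 0 < q - 1].
  by move: q_ge2 kappa_gt1 kappa_le2 => *; split; lra.
move=> S step k.
have [sigma [sigma0 ucphi stepM]] := step_condition_modulus S step.
have [[_ _ _ _ cf [df _] [[psiN _] _ _] _] [Xstar _] [[[phiN _] _ _] _ _] agd d0 m0E] := S.
have a0 := agd_weights agd.
have A0 := cumul_gt0 _ a0.
have M0 i : 0 < M i by exact: smooth_const_gt0.
have m00 : 0 < m0 by rewrite -m0E mulr_gt0.
have iA0 : 0 < (2 * cumul a k)^-1 by rewrite invr_gt0 mulr_gt0.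
case psis : (psi xstar) (psiN xstar) => [p| |]// _; last first.
  by rewrite {2}/composite psis addey//= addeNy leNye.
case phis : (phi xstar) (phiN xstar) => [r| |]// _; last first.
  have c0 : 0 < 2 * cumul a 0 * M 0%N by rewrite mulr_gt0 ?M0 ?mulr_gt0.
  by rewrite gt0_muley ?lte_fin ?addye ?gt0_mulye ?lte_fin ?leey.
have := agd_upper_bound _ _ _ _ _ _ _ _ _ _ _ _ _ _ _ _ q_ge2 kappa_gt1 kappa_le2
  L0 lam0 sigma0 S ucphi stepM _ _ k.
rewrite psis phis => /(_ isT isT) ub.
have lower : ((\sum_(i < k.+1) a i * f (x i))%:E + agd_objective f psi phi m0 a x k (v k)
    <= (cumul a k * (f xstar + p) + m0 * r)%:E)%E.
  apply: (le_trans (leeD2l _ ((agd_v agd k).2 xstar Xstar))).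
  rewrite /agd_objective psis phis -!EFinM -!EFinD lee_fin.
  rewrite !addrA lerD2r mulrDr lerD2r -big_split/= /cumul mulr_suml ler_sum// => i _.
  by rewrite -mulrDr ler_pM2l//; exact: convex_tangent_le.
have := le_trans ub (leeD2r _ lower).
rewrite [composite f psi xstar]/composite psis.
case fy : (composite f psi (y k)) => [s| |] /=; last by rewrite !addNye ?leNye.
  rewrite -!EFinM -!EFinD ?lee_fin => H.
  rewrite ler_pdivlMr ?mulr_gt0//.
  rewrite -(mulrA 2) -/M; move: m0E; rewrite -/M => ->; nra.
by rewrite gt0_muley ?lte_fin// -EFinD leye_eq.
Qed.

End Gap.

(** * Growth of sequences *)

Section Growth.
Context {R : realType}.
Implicit Types (p r s t x : R).

(** Young's inequality for (1 - t)^p and 1, with conjugate exponents 1/p and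
    1/(1-p). *)
Lemma powR_bernoulli p t : 0 < p -> p < 1 -> t <= 1 -> (1 - t) `^ p <= 1 - p * t.
Proof.
move=> p0 p1 t1.
have u0 : 0 <= 1 - t by rewrite subr_ge0.
have p1' : 0 < (1 - p)^-1 by rewrite invr_gt0 subr_gt0.
have ip : 0 < p^-1 by rewrite invr_gt0.
have pp : p^-1^-1 + (1 - p)^-1^-1 = 1 by rewrite !invrK; ring.
have := conjugate_powR (powR_ge0 (1 - t) p) ler01 ip p1' pp.
by rewrite mulr1 -powRrM mulfV ?gt_eqF// powRr1// powR1 !invrK; lra.
Qed.

Lemma expR_half_le t : 0 <= t -> t <= 1 -> expR (t / 2) <= 1 + t.
Proof.
move=> t0 t1.
have h : 0 < 1 - t / 2 by lra.
have e : 1 - t / 2 <= (expR (t / 2))^-1.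
  by rewrite -expRN; have := expR_ge1Dx (- (t / 2)); lra.
have : expR (t / 2) <= (1 - t / 2)^-1.
  by rewrite -[leLHS]invrK lef_pV2 ?posrE ?invr_gt0 ?expR_gt0.
move/le_trans; apply.
by rewrite -[_^-1]mul1r ler_pdivrMr//; nra.
Qed.

Lemma le_powR_root s x z : 0 < s -> 0 <= x -> 0 <= z ->
  (x <= z `^ s) = (x `^ s^-1 <= z).
Proof.
move=> s0 x0 z0.
have s0' : s != 0 by rewrite gt_eqF.
apply/idP/idP => H.
  have : x `^ s^-1 <= (z `^ s) `^ s^-1.
    by rewrite ge0_ler_powR ?nnegrE ?powR_ge0// invr_ge0 ltW.
  by rewrite -powRrM mulfV// powRr1.
have : (x `^ s^-1) `^ s <= z `^ s.
  by rewrite ge0_ler_powR ?nnegrE ?powR_ge0// ltW.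
by rewrite -powRrM mulVf// powRr1.
Qed.

(** A discrete form of A' >= A^(1-1/s), whose solutions satisfy
    (A^(1/s))' >= 1/s. With B = A_(k+1) and t = a_(k+1)/B the hypothesis reads
    B^(1/s) t >= 1, and A_k^(1/s) = B^(1/s) (1-t)^(1/s) <= B^(1/s) (1 - t/s). *)
Lemma polynomial_growth s (A a : nat -> R) : 1 < s ->
  (forall k, 0 < a k) -> (forall k, 0 < A k) ->
  (forall k, A k.+1 = A k + a k.+1) ->
  (forall k, A k.+1 `^ (s - 1) <= a k.+1 `^ s) ->
  forall k, (k%:R / s) `^ s <= A k.
Proof.
move=> s1 a0 A0 AS aA k.
have s0 : 0 < s by lra.
have is0 : 0 < s^-1 by rewrite invr_gt0.
have H : k%:R / s <= A k `^ s^-1.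
  elim: k => [|k IH]; first by rewrite mul0r powR_ge0.
  set B := A k.+1; pose t := a k.+1 / B.
  have B0 : 0 < B by exact: A0.
  have t0 : 0 < t by rewrite divr_gt0.
  have t1 : t <= 1 by rewrite ler_pdivrMr// mul1r /B AS lerDr ltW.
  have Ak : A k = B * (1 - t).
    by rewrite /t mulrBr mulr1 mulrCA mulfV ?gt_eqF// mulr1 /B AS addrK.
  have tB : 1 <= B `^ s^-1 * t.
    have : B^-1 <= t `^ s.
      rewrite /t powRM ?invr_ge0 ?(ltW B0) ?(ltW (a0 _))// powRV//.
      have pB : 0 < B `^ s by exact: powR_gt0.
      rewrite ler_pdivlMr// (le_trans _ (aA k))// -/B.
      by rewrite -(mulr_powRB1 (ltW B0) s0) mulKf ?gt_eqF.
    rewrite le_powR_root ?invr_ge0 ?(ltW B0) ?(ltW t0)// powRV//.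
    by rewrite -[_^-1]mul1r ler_pdivrMr ?powR_gt0// mulrC.
  have bern : (1 - t) `^ s^-1 <= 1 - s^-1 * t.
    by apply: powR_bernoulli => //; rewrite invf_lt1.
  move: IH; rewrite Ak powRM ?subr_ge0 ?(ltW B0)// => IH.
  have := ler_wpM2l (powR_ge0 B s^-1) bern.
  rewrite -natr1 mulrDl mul1r.
  have : s^-1 <= s^-1 * (B `^ s^-1 * t) by rewrite ler_peMr// ltW.
  lra.
by move: H; rewrite le_powR_root ?invrK ?divr_ge0 ?(ltW s0) ?(ltW (A0 k)).
Qed.

Lemma geometric_growth (tau : R) (A : nat -> R) : 0 <= tau -> tau <= 1 ->
  A 0%N = 1 -> (forall k, (1 + tau) * A k <= A k.+1) ->
  forall k, expR (k%:R * (tau / 2)) <= A k.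
Proof.
move=> t0 t1 A0 AS; elim=> [|k IH]; first by rewrite mul0r expR0 A0.
rewrite -natr1 mulrDl mul1r expRD mulrC (le_trans _ (AS k))//.
by rewrite ler_pM ?expR_ge0// expR_half_le.
Qed.

(** For t < 1 the factor (1+t)^r is at most 2^r; capping at 1 makes the bound
    valid for every t. *)
Lemma step_ratio_ge r s t (h : R) : 0 <= r -> 0 < s -> 0 < t -> 0 <= h ->
  h <= t `^ s * (1 + t) `^ r ->
  Num.min 1 ((h / 2 `^ r) `^ s^-1) <= t.
Proof.
move=> r0 s0 t0 h0 H.
rewrite ge_min.
have [//|t1] := leP 1 t; rewrite /=.
have p2 : 0 < 2 `^ r :> R by exact: powR_gt0.
rewrite -le_powR_root ?divr_ge0 ?(ltW t0) ?(ltW p2)//.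
rewrite ler_pdivrMr// (le_trans H)// ler_wpM2l ?powR_ge0//.
by rewrite ge0_ler_powR ?nnegrE//; lra.
Qed.

End Growth.

(** * The weights reach their target *)

Section Rates.
Context {R : realType} (q kappa : R).
Context (q_ge2 : 2 <= q) (kappa_gt1 : 1 < kappa) (kappa_le2 : kappa <= 2).
Implicit Types (L lam Phi eps : R).

(** The order s = q - (q - kappa)/kappa of the polynomial growth of A_k. *)
Definition growth_order : R := (q * kappa - q + kappa) / kappa.
Let s := growth_order.
Let r := (q - kappa) / kappa.

(** The value of m0 for a_0 = A_0 = 1, where delta_0 = eps. *)
Definition initial_const L eps : R := smooth_const q kappa L (cst eps) 0.

(** The value of A_k from which m0 Phi / A_k <= eps / 2. *)
Definition target L Phi eps : R := 2 * initial_const L eps * Phi / eps.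

Definition growth_rate L lam eps : R :=
  Num.min 1 ((lam / initial_const L eps / 2 `^ ((q - kappa) / kappa))
              `^ growth_order^-1).

Definition polynomial_iterations L Phi eps : nat :=
  (Num.truncn (growth_order * target L Phi eps `^ growth_order^-1)).+1.

Definition geometric_iterations L lam Phi eps : nat :=
  (Num.truncn (2 * ln (target L Phi eps) / growth_rate L lam eps)).+1.

(** For Phi = 0 the target is 0, and the bound to be met by the number of
    iterations is 0 as well. For lam = 0 there is no geometric growth. *)
Definition iterations L lam Phi eps : nat :=
  if Phi == 0 then 0%N else
  if lam == 0 then polynomial_iterations L Phi eps else
  minn (geometric_iterations L lam Phi eps) (polynomial_iterations L Phi eps).

Lemma exponent_facts : [/\ 0 < kappa, 0 < q, 0 <= r, 1 < s & q = s + r].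
Proof.
have k0 : 0 < kappa by move: kappa_gt1; lra.
have q0 : 0 < q by move: q_ge2; lra.
split => //.
- by rewrite divr_ge0 ?(ltW k0)// subr_ge0; move: kappa_le2 q_ge2; lra.
- by rewrite /s /growth_order ltr_pdivlMr//; move: q0 kappa_gt1; nra.
- by rewrite /s /r /growth_order; field; rewrite gt_eqF.
Qed.

Lemma smooth_const_scaled L eps (t delta : nat -> R) k :
  0 < eps -> 0 < t k -> delta k = t k * eps ->
  smooth_const q kappa L delta k = initial_const L eps * (t k)^-1 `^ r.
Proof.
have [k0 q0 r0 s1 qE] := exponent_facts.
move=> e0 t0 dE; rewrite /initial_const /smooth_const dE [RHS]mulrAC; congr (_ * _).
rewrite -/r -powRM ?invr_ge0 ?(ltW t0)//; last first.
  rewrite divr_ge0 ?mulr_ge0 ?(ltW e0) ?(ltW k0) ?(ltW q0)// subr_ge0.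
  by move: kappa_le2 q_ge2; lra.
by congr (_ `^ _); rewrite /=; field; rewrite !gt_eqF.
Qed.

Lemma initial_constE L eps : 0 < L -> 0 < eps ->
  initial_const L eps =
    (2 * (q - kappa) / (q * kappa)) `^ r * eps^-1 `^ r * L `^ (q / kappa).
Proof.
have [k0 q0 r0 s1 qE] := exponent_facts.
move=> L0 e0; rewrite /initial_const /smooth_const -/r; congr (_ * _).
rewrite -powRM ?invr_ge0 ?(ltW e0)//; last first.
  rewrite divr_ge0 ?mulr_ge0 ?(ltW k0) ?(ltW q0)// subr_ge0.
  by move: kappa_le2 q_ge2; lra.
by congr (_ `^ _); rewrite /=; field; rewrite !gt_eqF.
Qed.

Lemma initial_const_gt0 L eps : 0 < L -> 0 < eps -> 0 < initial_const L eps.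
Proof.
have [k0 q0 r0 s1 qE] := exponent_facts.
by move=> L0 e0; apply: smooth_const_gt0 => //; move: kappa_le2 q_ge2; lra.
Qed.

Lemma target_gt0 L Phi eps : 0 < L -> 0 < eps -> 0 < Phi -> 0 < target L Phi eps.
Proof.
by move=> L0 e0 P0; rewrite divr_gt0// mulr_gt0// mulr_gt0// initial_const_gt0.
Qed.

Section Recursion.
Context (L lam eps : R) (a : nat -> R).
Context (L0 : 0 < L) (lam0 : 0 <= lam) (eps0 : 0 < eps).
Context (a_gt0 : forall k, 0 < a k) (a0 : a 0%N = 1).
Let m0 := initial_const L eps.
Context (aE : forall k, (1 <= k)%N ->
  a k `^ q = step_max q lam m0 a k
    / smooth_const q kappa L (fun i => a i / cumul a i * eps) k).

(** With b = a_(k+1), A = A_(k+1) and B = A_k, both inequalities come from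
    b^s A^r m0 = max (lam B^q, m0 A^(q-1)), which is the equality defining
    a_(k+1) once M_(k+1) = m0 (A/b)^r is inserted. *)
Lemma maximal_step k :
  [/\ cumul a k.+1 `^ (s - 1) <= a k.+1 `^ s &
   lam / m0 <= (a k.+1 / cumul a k) `^ s * (1 + a k.+1 / cumul a k) `^ r].
Proof.
have [k0 q0 r0 s1 qE] := exponent_facts.
have A0 := cumul_gt0 _ a_gt0.
have m00 : 0 < m0 by exact: initial_const_gt0.
set A := cumul a k.+1; set B := cumul a k; set b := a k.+1.
have AB : 0 < A by exact: A0.
have BB : 0 < B by exact: A0.
have bb : 0 < b by exact: a_gt0.
have [pA pB pb] : [/\ 0 < A `^ r, 0 < B `^ r & 0 < b `^ r] by rewrite !powR_gt0.
have [pA' pB' pb'] : [/\ 0 < A `^ s, 0 < B `^ s & 0 < b `^ s] by rewrite !powR_gt0.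
have qD (z : R) : 0 < z -> z `^ q = z `^ s * z `^ r.
  by move=> z0; rewrite qE powRD// (gt_eqF z0) implybT.
have eqb : b `^ s * A `^ r * m0 = Num.max (lam * B `^ q) (m0 * A `^ (q - 1)).
  have := aE k.+1 isT.
  rewrite -/b (smooth_const_scaled L eps (fun i => a i / cumul a i))//; last first.
    by rewrite divr_gt0.
  rewrite -/A -/b -/m0 invf_div powRM ?invr_ge0 ?(ltW AB) ?(ltW bb)// powRV//.
  rewrite /step_max /= -/A -/B qD// => e.
  transitivity (b `^ s * b `^ r * (m0 * (A `^ r / b `^ r))).
    by field; rewrite gt_eqF.
  by rewrite e divfK// gt_eqF// mulr_gt0// divr_gt0.
split.
  have : m0 * A `^ (q - 1) <= b `^ s * A `^ r * m0 by rewrite eqb le_max lexx orbT.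
  have -> : q - 1 = (s - 1) + r by rewrite qE; ring.
  rewrite powRD ?(gt_eqF AB) ?implybT// mulrC ler_pM2r//.
  by rewrite ler_pM2r.
have H : lam * B `^ q <= b `^ s * A `^ r * m0 by rewrite eqb le_max lexx.
have -> : 1 + b / B = A / B.
  by rewrite /A cumulS -/B -/b; field; rewrite gt_eqF.
rewrite !powRM ?invr_ge0 ?(ltW BB) ?(ltW bb) ?(ltW AB)// !powRV// ler_pdivrMr//.
rewrite [leRHS](_ : _ = b `^ s * A `^ r * m0 / B `^ q); last first.
  by rewrite qD//; field; rewrite !gt_eqF.
by rewrite ler_pdivlMr// powR_gt0.
Qed.

Lemma polynomial_target Phi k : 0 < Phi ->
  (polynomial_iterations L Phi eps <= k)%N -> target L Phi eps <= cumul a k.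
Proof.
have [k0 q0 r0 s1 qE] := exponent_facts.
have s0 : 0 < s by apply: lt_trans s1.
move=> P0 kK.
have T0 := target_gt0 _ _ _ L0 eps0 P0.
apply: (le_trans _ (polynomial_growth _ _ _ s1 a_gt0 (cumul_gt0 _ a_gt0)
  (cumulS a) (fun k => proj1 (maximal_step k)) k)).
have ks0 : 0 <= k%:R / s by exact: divr_ge0 (ler0n _ _) (ltW s0).
rewrite le_powR_root ?(ltW T0)//.
rewrite ler_pdivlMr// mulrC ltW// (lt_le_trans (truncnS_gt _))//.
by rewrite ler_nat.
Qed.

Lemma geometric_target Phi k : 0 < Phi -> 0 < lam ->
  (geometric_iterations L lam Phi eps <= k)%N -> target L Phi eps <= cumul a k.
Proof.
have [k0 q0 r0 s1 qE] := exponent_facts.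
have s0 : 0 < s by apply: lt_trans s1.
move=> P0 l0 kK.
have T0 := target_gt0 _ _ _ L0 eps0 P0.
have m00 : 0 < m0 by exact: initial_const_gt0.
set tau := growth_rate L lam eps.
have tau0 : 0 < tau.
  by rewrite lt_min ltr01 powR_gt0// !divr_gt0// powR_gt0.
have tau1 : tau <= 1 by rewrite ge_min lexx.
have A0 := cumul_gt0 _ a_gt0.
have A00 : cumul a 0 = 1 by rewrite cumul0.
apply: (le_trans _ (geometric_growth tau _ (ltW tau0) tau1 A00 _ k)).
  rewrite -[leLHS]lnK ?posrE// ler_expR mulrA ler_pdivlMr// mulrC -ler_pdivrMr//.
  by rewrite ltW// (lt_le_trans (truncnS_gt _))// ler_nat.
move=> i.
have [_ h] := maximal_step i.
have := step_ratio_ge r s (a i.+1 / cumul a i) (lam / m0) r0 s0.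
rewrite divr_gt0// divr_ge0 ?(ltW m00)// => /(_ isT isT h) taule.
by rewrite cumulS mulrDl mul1r lerD2l -ler_pdivlMr.
Qed.

Lemma iterations_target Phi k : 0 < Phi ->
  (iterations L lam Phi eps <= k)%N -> target L Phi eps <= cumul a k.
Proof.
move=> P0; rewrite /iterations gt_eqF//.
have [_|l0] := eqVneq lam 0; first exact: polynomial_target.
rewrite geq_min => /orP[|]; last exact: polynomial_target.
by apply: geometric_target => //; rewrite lt_neqAle eq_sym l0.
Qed.

End Recursion.
End Rates.

(** * Comparison with the stated iteration bound *)

Section IterationBound.
Context {R : realType} (q kappa : R).
Context (q_ge2 : 2 <= q) (kappa_gt1 : 1 < kappa) (kappa_le2 : kappa <= 2).
Implicit Types (L lam Phi eps : R).
Let s := growth_order q kappa.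
Let r := (q - kappa) / kappa.
Let D := q * kappa - q + kappa.
Let c := (2 * (q - kappa) / (q * kappa)) `^ r.

Lemma young_const_gt0 : 0 < c.
Proof.
have [k0 q0 r0 s1 qE] := exponent_facts q kappa q_ge2 kappa_gt1 kappa_le2.
have := initial_const_gt0 q kappa q_ge2 kappa_gt1 kappa_le2 1 1 ltr01 ltr01.
rewrite initial_constE//; have := powR_ge0 (2 * (q - kappa) / (q * kappa)) r.
by rewrite -/r -/c le_eqVlt => /orP[/eqP <-|//]; rewrite !mul0r ltxx.
Qed.

Lemma inv_growth_order : s^-1 = kappa / D.
Proof. by rewrite /s /growth_order invf_div. Qed.

Lemma denominator_gt0 : 0 < D.
Proof. by move: q_ge2 kappa_gt1; rewrite /D; nra. Qed.

Lemma targetE L Phi eps : 0 < L -> 0 < eps ->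
  target q kappa L Phi eps = 2 * c * Phi * (L / eps) `^ (q / kappa).
Proof.
have [k0 q0 r0 s1 qE] := exponent_facts q kappa q_ge2 kappa_gt1 kappa_le2.
move=> L0 e0; rewrite /target initial_constE// -/r -/c.
have -> : q / kappa = r + 1 by rewrite /r; field; rewrite gt_eqF.
rewrite powRM ?invr_ge0 ?(ltW L0) ?(ltW e0)//.
rewrite !powRD ?invr_eq0 ?(gt_eqF e0) ?(gt_eqF L0) ?implybT//.
by rewrite !powRr1 ?invr_ge0 ?ltW//; field; rewrite gt_eqF.
Qed.

(** The nonnegativity of b matters because the truncation of a negative number
    is 0. *)
Lemma truncnS_le (z b : R) : 0 <= b -> z <= b -> (Num.truncn z).+1%:R <= b + 1.
Proof.
move=> b0 zb; rewrite -natr1 lerD2r.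
have [z0|z0] := leP 0 z; first by rewrite (le_trans _ zb)// truncn_le.
have /truncn0Pn -> // : ~~ (1 <= z) by rewrite -ltNge; lra.
Qed.

Let poly_bound L Phi eps := (L / eps) `^ (q / D) * Phi `^ (kappa / D).
Let geometric_prefactor L lam eps :=
  (1 / eps) `^ ((q - kappa) / D)
  * Num.max (L `^ (q / kappa) / lam) 1 `^ (kappa / D).

Lemma polynomial_iterations_le L Phi eps : 0 < L -> 0 < Phi -> 0 < eps ->
  (polynomial_iterations q kappa L Phi eps)%:R
    <= s * (2 * c) `^ s^-1 * poly_bound L Phi eps + 1.
Proof.
have [k0 q0 r0 s1 qE] := exponent_facts q kappa q_ge2 kappa_gt1 kappa_le2.
move=> L0 P0 e0; have c0 := young_const_gt0; have D0 := denominator_gt0.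
have s0 : 0 <= s by apply/ltW; apply: lt_trans s1.
apply: truncnS_le.
  by apply: mulr_ge0 (mulr_ge0 s0 (powR_ge0 _ _)) (mulr_ge0 (powR_ge0 _ _) (powR_ge0 _ _)).
rewrite -/s targetE// powRM ?powR_ge0 ?mulr_ge0 ?(ltW c0) ?(ltW P0)//.
rewrite powRM ?mulr_ge0 ?(ltW c0) ?(ltW P0)//.
rewrite -[(_ `^ (q / kappa)) `^ _]powRrM /poly_bound -inv_growth_order.
have -> : q / kappa / s = q / D by rewrite inv_growth_order; field; rewrite !gt_eqF.
by rewrite le_eqVlt; apply/orP; left; apply/eqP; ring.
Qed.

Lemma geometric_prefactor_ge1 L lam eps :
  0 < eps -> eps <= 1 -> 1 <= geometric_prefactor L lam eps.
Proof.
have [k0 q0 r0 s1 qE] := exponent_facts q kappa q_ge2 kappa_gt1 kappa_le2.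
move=> e0 e1; have D0 := denominator_gt0.
have p1 : 1 <= (1 / eps) `^ ((q - kappa) / D).
  rewrite -[leLHS](powRr0 (1 / eps)) ler_powR ?div1r ?invf_ge1//.
  by rewrite divr_ge0 ?(ltW D0)// subr_ge0; move: q_ge2 kappa_le2; lra.
have p2 : 1 <= Num.max (L `^ (q / kappa) / lam) 1 `^ (kappa / D).
  rewrite -[leLHS](powRr0 (Num.max (L `^ (q / kappa) / lam) 1)) ler_powR ?le_max ?lexx ?orbT//.
  by rewrite divr_ge0 ?ltW.
by rewrite /geometric_prefactor -[leLHS]mulr1 ler_pM.
Qed.

(** An upper bound of 1/tau, written without dividing by the minimum: the maximum
    with 1 in the prefactor accounts for the cap tau <= 1, and eps <= 1 makes the
    power of 1/eps at least 1. *)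
Lemma growth_rate_inv_le L lam eps : 0 < L -> 0 < lam -> 0 < eps -> eps <= 1 ->
  1 <= Num.max 1 ((c * 2 `^ r) `^ s^-1) * geometric_prefactor L lam eps
         * growth_rate q kappa L lam eps.
Proof.
have [k0 q0 r0 s1 qE] := exponent_facts q kappa q_ge2 kappa_gt1 kappa_le2.
move=> L0 l0 e0 e1; have c0 := young_const_gt0; have D0 := denominator_gt0.
have s0 : 0 < s^-1 by rewrite invr_gt0; apply: lt_trans s1.
set C := Num.max 1 _.
have C1 : 1 <= C by rewrite le_max lexx.
have P1 := geometric_prefactor_ge1 L lam eps e0 e1.
rewrite /growth_rate -/r -/s.
set h := (_ / _ / _) `^ _.
have [hle|hlt] := leP 1 h; first by rewrite mulr1 -[leLHS]mulr1 ler_pM.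
have lq : 0 < L `^ (q / kappa) by exact: powR_gt0.
have t2 : 0 < 2 `^ r :> R by exact: powR_gt0.
have u0 : 0 < c * 2 `^ r by exact: mulr_gt0.
have z0 : 0 < L `^ (q / kappa) / lam by exact: divr_gt0.
have ie0 : 0 < 1 / eps by rewrite divr_gt0.
have -> : h = ((c * 2 `^ r) `^ s^-1
    * ((1 / eps) `^ ((q - kappa) / D)
       * (L `^ (q / kappa) / lam) `^ (kappa / D)))^-1.
  rewrite -inv_growth_order.
  have -> : (q - kappa) / D = r / s.
    by rewrite /r inv_growth_order; field; rewrite !gt_eqF.
  have w0 : 0 < (1 / eps) `^ r by rewrite powR_gt0// divr_gt0.
  rewrite (powRrM (1 / eps)) -(powRM _ (ltW w0) (ltW z0)).
  rewrite -(powRM _ (ltW u0) (ltW (mulr_gt0 w0 z0))).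
  rewrite -powRV; last exact: mulr_gt0 u0 (mulr_gt0 w0 z0).
  rewrite /h; congr (_ `^ _); rewrite initial_constE// -/r -/c div1r.
  have e2 : 0 < eps^-1 `^ r by rewrite powR_gt0// invr_gt0.
  by field; rewrite !gt_eqF.
set Z := (c * 2 `^ r) `^ _ * _; have Z0 : 0 < Z.
  exact: mulr_gt0 (powR_gt0 _ u0) (mulr_gt0 (powR_gt0 _ ie0) (powR_gt0 _ z0)).
rewrite ler_pdivlMr// mul1r /Z ler_pM ?mulr_ge0 ?powR_ge0//.
  by rewrite le_max lexx orbT.
rewrite /geometric_prefactor ler_wpM2l ?powR_ge0// ge0_ler_powR ?nnegrE ?le_max ?lexx//.
- by rewrite divr_ge0 ?ltW.
- by rewrite divr_ge0 ?ltW.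
- by rewrite ler01 orbT.
Qed.

(** The target is 2 c Phi (L/eps)^(q/kappa), so its logarithm is
    (q/kappa) ln(L Phi/eps) plus a term independent of eps, which is absorbed by
    doubling the factor. *)
Lemma ln_target_le L Phi eps : 0 < L -> 0 < Phi -> 0 < eps ->
  `|ln (2 * c * Phi) - q / kappa * ln Phi| <= ln (L * Phi / eps) ->
  ln (target q kappa L Phi eps) <= 2 * q / kappa * ln (L * Phi / eps).
Proof.
have [k0 q0 r0 s1 qE] := exponent_facts q kappa q_ge2 kappa_gt1 kappa_le2.
move=> L0 P0 e0; have c0 := young_const_gt0 => H.
have cP : 0 < 2 * c * Phi by rewrite mulr_gt0// mulr_gt0.
have Le : 0 < L / eps by exact: divr_gt0.
rewrite targetE// lnM ?posrE ?powR_gt0// ln_powR.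
have lE : ln (L / eps) = ln (L * Phi / eps) - ln Phi.
  rewrite -ln_div ?posrE ?divr_gt0 ?mulr_gt0//; congr ln.
  by field; rewrite !gt_eqF.
rewrite lE.
have := le_trans (ler_norm _) H.
set l := ln (L * Phi / eps); set u := ln (2 * c * Phi); set z := ln Phi => h.
have l0 : 0 <= l by exact: le_trans H.
have qk : 1 <= q / kappa by rewrite ler_pdivlMr// mul1r; move: q_ge2 kappa_le2; lra.
have : l <= q / kappa * l by rewrite ler_peMl.
rewrite -(mulrA 2); set w := q / kappa in h *; nra.
Qed.

Lemma geometric_iterations_le L lam Phi eps :
  0 < L -> 0 < Phi -> 0 < lam -> 0 < eps -> eps <= 1 ->
  1 <= ln (L * Phi / eps) ->
  `|ln (2 * c * Phi) - q / kappa * ln Phi| <= ln (L * Phi / eps) ->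
  (geometric_iterations q kappa L lam Phi eps)%:R
  <= (4 * q / kappa * Num.max 1 ((c * 2 `^ r) `^ s^-1) + 1)
     * (geometric_prefactor L lam eps * ln (L * Phi / eps)).
Proof.
have [k0 q0 r0 s1 qE] := exponent_facts q kappa q_ge2 kappa_gt1 kappa_le2.
move=> L0 P0 l0 e0 e1 ln1 lnT.
have H := ln_target_le L Phi eps L0 P0 e0 lnT.
have G := growth_rate_inv_le L lam eps L0 l0 e0 e1.
have P1 := geometric_prefactor_ge1 L lam eps e0 e1.
set l := ln (L * Phi / eps) in ln1 lnT H *.
set C1 := Num.max 1 _ in G *; set tau := growth_rate _ _ _ _ _ in G.
have C10 : 0 <= C1 by rewrite le_max ler01.
have tau0 : 0 < tau.
  rewrite lt_min ltr01 powR_gt0// !divr_gt0 ?powR_gt0//.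
  exact: initial_const_gt0.
have Pl : 1 <= geometric_prefactor L lam eps * l by rewrite -[leLHS]mulr1 ler_pM.
rewrite mulrDl mul1r.
apply: (@le_trans _ _ (4 * q / kappa * C1 * (geometric_prefactor L lam eps * l) + 1));
  last by rewrite lerD2l.
apply: truncnS_le.
  have C1' : 0 <= 4 * q / kappa * C1.
    by rewrite !mulr_ge0 ?invr_ge0 ?(ltW k0) ?(ltW q0).
  by rewrite mulr_ge0//; exact: le_trans ler01 Pl.
rewrite -/tau ler_pdivrMr//.
apply: (@le_trans _ _ (4 * q / kappa * l)).
  by rewrite -(mulrA 4) -(mulrA 2) in H *; move: H; lra.
rewrite [leRHS](_ : _ = (4 * q / kappa * l)
  * (C1 * geometric_prefactor L lam eps * tau)); last by ring.
rewrite ler_peMr// !mulr_ge0 ?invr_ge0 ?(ltW k0) ?(ltW q0)//; move: ln1; lra.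
Qed.

(** For Phi > 0 both terms of the bound are at least 1 for small eps, so that they
    absorb the 1 added in rounding up. The smallness required of eps depends on L and Phi
    only. *)
Lemma iterations_le_bound : exists C : R, forall L Phi, 0 < L -> 0 <= Phi ->
  \forall eps \near 0^'+, forall lam, 0 <= lam ->
    (iterations q kappa L lam Phi eps)%:R
      <= C * iteration_bound q kappa L lam Phi eps.
Proof.
have [k0 q0 r0 s1 qE] := exponent_facts q kappa q_ge2 kappa_gt1 kappa_le2.
have c0 := young_const_gt0; have D0 := denominator_gt0.
pose C2 := s * (2 * c) `^ s^-1.
pose C1 := 4 * q / kappa * Num.max 1 ((c * 2 `^ r) `^ s^-1).
have C20 : 0 <= C2 by rewrite mulr_ge0 ?powR_ge0//; exact/ltW/(lt_trans ltr01 s1).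
have C10 : 0 <= C1.
  rewrite mulr_ge0 ?le_max ?ler01//.
  by rewrite !mulr_ge0 ?invr_ge0 ?(ltW k0) ?(ltW q0).
exists (C1 + 1 + (C2 + 1)) => L Phi L0.
rewrite le_eqVlt => /orP[/eqP <-|P0].
  near=> eps => lam lam0.
  rewrite /iterations eqxx /iteration_bound -/D mulr0 mul0r ln0// mulr0.
  rewrite powR0 ?mulr0 ?minxx ?if_same ?mulr0//.
  by rewrite gt_eqF// divr_gt0.
pose T := 1 + `|ln (2 * c * Phi) - q / kappa * ln Phi|.
near=> eps => lam lam0.
have e0 : 0 < eps by [].
have e1 : eps <= 1 by near: eps; exact: nbhs_right_ltW.
have lT : T <= ln (L * Phi / eps).
  rewrite -[leLHS]expRK ler_ln ?posrE ?expR_gt0 ?divr_gt0 ?mulr_gt0//.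
  rewrite ler_pdivlMr// mulrC -ler_pdivlMr ?expR_gt0//.
  by near: eps; apply: nbhs_right_ltW; rewrite divr_gt0 ?mulr_gt0 ?expR_gt0.
have poly_bound_ge1 : 1 <= poly_bound L Phi eps.
  have -> : poly_bound L Phi eps = (L / eps * Phi `^ (kappa / q)) `^ (q / D).
    rewrite /poly_bound [RHS]powRM ?powR_ge0 ?divr_ge0 ?(ltW L0) ?(ltW e0)// -powRrM.
    by congr (_ * _ `^ _); field; rewrite !gt_eqF.
  have pos : 0 <= L / eps * Phi `^ (kappa / q).
    by rewrite mulr_ge0 ?powR_ge0// ltW// divr_gt0.
  have -> : 1 = 1 `^ (q / D) :> R by rewrite powR1.
  rewrite ge0_ler_powR ?nnegrE//; first by rewrite ltW// divr_gt0.
  rewrite mulrAC ler_pdivlMr// mul1r.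
  by near: eps; apply: nbhs_right_ltW; rewrite mulr_gt0 ?powR_gt0.
have poly : (polynomial_iterations q kappa L Phi eps)%:R
    <= (C1 + 1 + (C2 + 1)) * poly_bound L Phi eps.
  apply: (le_trans (polynomial_iterations_le L Phi eps L0 P0 e0)).
  rewrite -/C2 mulrDl [X in _ <= _ + X]mulrDl mul1r.
  have : 0 <= (C1 + 1) * poly_bound L Phi eps.
    by rewrite mulr_ge0//; move: poly_bound_ge1 C10; lra.
  by move: poly_bound_ge1; lra.
rewrite /iterations gt_eqF// /iteration_bound -/D.
have [//|l0] := eqVneq lam 0.
have l0' : 0 < lam by rewrite lt_neqAle eq_sym l0.
rewrite -/(geometric_prefactor L lam eps) -/(poly_bound L Phi eps).
have nT : `|ln (2 * c * Phi) - q / kappa * ln Phi| <= ln (L * Phi / eps).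
  by apply: le_trans lT; rewrite /T lerDr.
have T1 : 1 <= ln (L * Phi / eps) by apply: le_trans lT; rewrite /T lerDl.
have geo : (geometric_iterations q kappa L lam Phi eps)%:R <=
    (C1 + 1 + (C2 + 1)) * (geometric_prefactor L lam eps * ln (L * Phi / eps)).
  apply: (le_trans (geometric_iterations_le L lam Phi eps L0 P0 l0' e0 e1 T1 nT)).
  rewrite -/C1 [leRHS]mulrDl lerDl mulr_ge0//; first by move: C20; lra.
  by rewrite mulr_ge0//; [have := geometric_prefactor_ge1 L lam eps e0 e1; lra|move: T1; lra].
rewrite /Num.min; case: ifP => _.
  by apply: le_trans geo; rewrite ler_nat geq_minl.
by apply: le_trans poly; rewrite ler_nat geq_minr.
Unshelve. all: by end_near.
Qed.

End IterationBound.

Theorem theorem2 (R : realType) (q kappa : R)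
    (q_ge2 : 2 <= q) (kappa_gt1 : 1 < kappa) (kappa_le2 : kappa <= 2) :
  (forall (E : normedModType R) (X : set E) (f : E -> R)
      (psi phi : E -> \bar R) (L lam m0 : R) (a delta : nat -> R)
      (x v y : nat -> E) (xstar : E),
    0 < L -> 0 <= lam ->
    agd_setting q kappa L lam X f psi phi xstar m0 a delta x v y ->
    (forall k, (1 <= k)%N ->
      a k `^ q <= step_max q lam m0 a k / smooth_const q kappa L delta k) ->
    forall k, (1 <= k)%N ->
      (composite f psi (y k) - composite f psi xstar
       <= ((2 * cumul a 0 * smooth_const q kappa L delta 0)%:E * phi xstar
           + (\sum_(i < k.+1) cumul a i * delta i)%:E)
          * ((2 * cumul a k)^-1)%:E)%E)
  /\
  (exists (C : R) (K : R -> R -> R -> R -> nat),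
    (forall L Phi : R, 0 < L -> 0 <= Phi ->
      \forall eps \near 0^'+, forall lam : R, 0 <= lam ->
        (K L lam Phi eps)%:R <= C * iteration_bound q kappa L lam Phi eps)
    /\
    (forall (E : normedModType R) (X : set E) (f : E -> R)
        (psi phi : E -> \bar R) (L lam m0 eps Phi : R) (a : nat -> R)
        (x v y : nat -> E) (xstar : E),
      0 < L -> 0 <= lam -> 0 < eps -> phi xstar = Phi%:E ->
      agd_setting q kappa L lam X f psi phi xstar m0 a
        (fun k => a k / cumul a k * eps) x v y ->
      a 0%N = 1 ->
      (forall k, (1 <= k)%N ->
        a k `^ q = step_max q lam m0 a k
          / smooth_const q kappa L (fun i => a i / cumul a i * eps) k) ->
      forall k, (K L lam Phi eps <= k)%N ->
        (composite f psi (y k) - composite f psi xstar <= eps%:E)%E)).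
Proof.
split.
  move=> E X f psi phi L lam m0 a delta x v y xstar L0 lam0 S step k _.
  exact: (agd_gap _ _ _ _ _ _ _ _ _ _ _ _ _ _ _
    q_ge2 kappa_gt1 kappa_le2 L0 lam0 S step).
have [C iterC] := iterations_le_bound q kappa q_ge2 kappa_gt1 kappa_le2.
exists C, (iterations q kappa); split => //.
move=> E X f psi phi L lam m0 eps Phi a x v y xstar L0 lam0 e0 phiE S a01 aE k kK.
have agd := setting_agd S.
have a_gt0 := agd_weights agd.
have A0 := cumul_gt0 _ a_gt0.
have A00 : cumul a 0 = 1 by rewrite cumul0.
have Phi0 : 0 <= Phi.
  rewrite -lee_fin -phiE; apply: le_trans (regularizer_ge (setting_regularizer S) xstar).
  by rewrite lee_fin mulr_ge0 ?powR_ge0// invr_ge0; move: q_ge2; lra.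
have m0E : m0 = initial_const q kappa L eps.
  rewrite -(setting_m0 S) A00 mul1r.
  rewrite (smooth_const_scaled q kappa q_ge2 kappa_gt1 kappa_le2 L eps (fun=> 1))//.
    by rewrite invr1 powR1 mulr1.
  by rewrite a01 A00 divr1.
have aLe i : (1 <= i)%N -> a i `^ q <= step_max q lam m0 a i
    / smooth_const q kappa L (fun i => a i / cumul a i * eps) i.
  by move=> i1; rewrite aE.
have gap := agd_gap _ _ _ _ _ _ _ _ _ _ _ _ _ _ _
  q_ge2 kappa_gt1 kappa_le2 L0 lam0 S aLe k.
rewrite m0E in aE.
apply: (le_trans gap).
rewrite phiE -mulrA (setting_m0 S) m0E.
rewrite -[leLHS]/(_%:E) lee_fin.
have -> : \sum_(i < k.+1) cumul a i * (a i / cumul a i * eps) = cumul a k * eps.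
  rewrite /cumul mulr_suml; apply: eq_bigr => i _; rewrite -/(cumul a i).
  by field; rewrite gt_eqF.
rewrite ler_pdivrMr ?mulr_gt0//.
suff : 2 * initial_const q kappa L eps * Phi <= eps * cumul a k by lra.
have [->|Pn0] := eqVneq Phi 0; first by rewrite mulr0 mulr_ge0 ?ltW.
have P0 : 0 < Phi by rewrite lt_neqAle eq_sym Pn0.
have := iterations_target q kappa q_ge2 kappa_gt1 kappa_le2 L lam eps a
  L0 lam0 e0 a_gt0 a01 aE Phi k P0 kK.
by rewrite /target ler_pdivrMr// [X in _ -> _ <= X]mulrC.
Qed.
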